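(* Let $n\ge1$ and let $g=g_{ij}(u)\,du^idu^j$, $u=(u^1,\dots,u^n)$ (real or complex), be a metric with $\det g_{ij}\not\equiv0$ such that $J=D\left(g^{ij}D+c^{ij}_ku^k_x\right)D$ is an $n$-component homogeneous third-order Hamiltonian operator. Here $g^{ij}$ is the inverse matrix of $g_{ij}$. Then the singular variety of the quadratic line complex in $\mathbb{P}^n$ with Monge metric $g$ is a double hypersurface of degree $n-1$. That is, the homogeneous form of degree $2n-2$ in $u^1,\dots,u^{n+1}$ obtained by homogenising $\det g_{ij}$ equals $\kappa\,S^2$, where $\kappa$ is a nonzero constant and $S$ is a homogeneous polynomial of degree $n-1$ in $u^1,\dots,u^{n+1}$.
   Context: Hamiltonian operators. $D=d/dx$ is the total $x$-derivative, and $g^{ij},c^{ij}_k$ are functions of the dependent variables $u=(u^1,\dots,u^n)$ with $\det g^{ij}\neq0$. $J$ is Hamiltonian if the bracket $\{F,G\}=\int\frac{\delta F}{\delta u^i}J^{ij}\frac{\delta G}{\delta u^j}\,dx$ is skew-symmetric and satisfies the Jacobi identity. Put $c_{ijk}=g_{iq}g_{jp}c^{pq}_k$. With a comma denoting partial derivative, the following characterisation is known and may be used as the definition: $J$ is Hamiltonian if and only if $g_{ij}$ is symmetric and $$g_{mn,k}=-c_{mnk}-c_{nmk},\quad c_{mnk}=-c_{mkn},\quad c_{mnk}+c_{nkm}+c_{kmn}=0,\quad c_{mnk,l}=-g^{pq}c_{pml}c_{qnk}.$$ Quadratic complexes and Monge metrics. It is known that these relations force $g$ to be a Monge metric, i.e.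 a quadratic form with constant coefficients in the expressions $du^i$ and $u^jdu^k-u^kdu^j$ ($1\le i,j,k\le n$). Equivalently, $g$ is obtained from a quadratic form in the Plücker coordinates $p^{ab}=u^adu^b-u^bdu^a$ ($1\le a,b\le n+1$) by setting $u^{n+1}=1$, $du^{n+1}=0$. Vanishing of that quadratic form in Plücker coordinates defines the corresponding quadratic line complex (a family of lines in $\mathbb{P}^n$). Singular variety. For a Monge metric, $\det g_{ij}$ is a polynomial of degree at most $2n-2$ in $u^1,\dots,u^n$. The singular variety of the complex is the hypersurface of degree $2n-2$ in $\mathbb{P}^n$ given by $\det g_{ij}=0$, i.e. the zero scheme of the degree-$(2n-2)$ homogenisation $(u^{n+1})^{2n-2}\det g_{ij}\big(u^1/u^{n+1},\dots,u^n/u^{n+1}\big)$. The hyperplane at infinity $u^{n+1}=0$ may be a component. *)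

(* Defs.v *)
From HB Require Import structures.
From mathcomp Require Import all_boot all_order all_algebra.
From mathcomp Require Import complex.
From mathcomp Require Import classical_sets reals topology normedtype derive.
(* The notations of mpoly clash with those of the analysis library. *)
From mathcomp Require Import -(notations) mpoly.

Set Implicit Arguments.
Unset Strict Implicit.
Unset Printing Implicit Defensive.

Import Order.TTheory GRing.Theory Num.Theory.
Import numFieldNormedType.Exports.

Local Open Scope ring_scope.

Notation "{ 'mpoly' R [ n ] }" := (mpoly n R)
  (at level 0, R, n at level 2, format "{ 'mpoly'  R [ n ] }").
Notation mvar i := (mpolyX _ (mnm1 i)).
Notation homogeneous d p := (p \is ishomog1 d mdeg).

Section Hamiltonian.
Variables (K : numFieldType) (n : nat).
Implicit Types (f : 'rV[K]_n -> K) (g : 'rV[K]_n -> 'M[K]_n).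
Implicit Types (c : 'I_n -> 'I_n -> 'I_n -> 'rV[K]_n -> K).

Definition pderiv f (k : 'I_n) (u : 'rV[K]_n) : K := 'D_(delta_mx 0 k) f u.

(* [c i j k] is c^{ij}_k; [lowerc g c i j k] is c_{ijk} = g_iq g_jp c^{pq}_k.
   Note the crossing of the indices. *)
Definition lowerc g c (i j k : 'I_n) (u : 'rV[K]_n) : K :=
  \sum_q \sum_p g u i q * g u j p * c p q k u.

(* The operator D (g^{ij} D + c^{ij}_k u^k_x) D is Hamiltonian on the domain U.
   The data are the metric g_{ij} and the functions c^{ij}_k; g^{ij} is
   [invmx (g u)], so g has to be nondegenerate at every point of U.
   For K = C, [differentiable] means holomorphic. *)
Record hamiltonian (U : set 'rV[K]_n) g c : Prop := Hamiltonian {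
  metric_differentiable : forall u, U u ->
    forall i j, differentiable (fun v => g v i j) u;
  coef_differentiable : forall u, U u ->
    forall i j k, differentiable (c i j k) u;
  metric_nondegenerate : forall u, U u -> \det (g u) != 0;
  metric_symmetric : forall u, U u -> forall i j, g u i j = g u j i;
  metric_pderiv : forall u, U u -> forall m n k,
    pderiv (fun v => g v m n) k u = - lowerc g c m n k u - lowerc g c n m k u;
  lowerc_skew : forall u, U u -> forall m n k,
    lowerc g c m n k u = - lowerc g c m k n u;
  lowerc_cyclic : forall u, U u -> forall m n k,
    lowerc g c m n k u + lowerc g c n k m u + lowerc g c k m n u = 0;
  lowerc_pderiv : forall u, U u -> forall m n k l,
    pderiv (lowerc g c m n k) l u =
    - \sum_p \sum_q
        invmx (g u) p q * lowerc g c p m l u * lowerc g c q n k u }.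

End Hamiltonian.

Section Complex.
Variables (K : numFieldType) (n : nat).

(* Homogeneous coordinates on P^n are indexed by 'I_n.+1, the last index
   [ord_max] being that of u^{n+1}; [affine i] is the index of u^i, i <= n. *)
Definition affine (i : 'I_n) : 'I_n.+1 := lift ord_max i.

Definition affine_coord (a : 'I_n.+1) : {mpoly K[n]} :=
  if unlift ord_max a is Some i then mvar i else 1.

(* The coefficient of du^i in p^{ab} = u^a du^b - u^b du^a, where u^{n+1} = 1
   and du^{n+1} = 0. *)
Definition plucker (ab : 'I_n.+1 * 'I_n.+1) (i : 'I_n) : {mpoly K[n]} :=
  affine_coord ab.1 * (ab.2 == affine i)%:R
  - affine_coord ab.2 * (ab.1 == affine i)%:R.

(* A quadratic form sum Q_{ab,cd} p^{ab} p^{cd} in the Plücker coordinates is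
   given by its coefficients, with Q_{ab,cd} = Q_{cd,ab}. *)
Definition symmetric_form (Q : 'I_n.+1 * 'I_n.+1 -> 'I_n.+1 * 'I_n.+1 -> K) :=
  forall s t, Q s t = Q t s.

Definition monge_metric (Q : 'I_n.+1 * 'I_n.+1 -> 'I_n.+1 * 'I_n.+1 -> K) :
    'M[{mpoly K[n]}]_n :=
  \matrix_(i, j) \sum_s \sum_t Q s t *: (plucker s i * plucker t j).

Definition is_monge_metric_of (U : set 'rV[K]_n) (g : 'rV[K]_n -> 'M[K]_n)
    (Q : 'I_n.+1 * 'I_n.+1 -> 'I_n.+1 * 'I_n.+1 -> K) : Prop :=
  symmetric_form Q /\
  forall u, U u -> g u = map_mx (meval (fun i => u 0 i)) (monge_metric Q).

(* (u^{n+1})^d p(u^1 / u^{n+1}, ..., u^n / u^{n+1}). The subtraction is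
   truncated: if deg p > d, the result is not homogeneous of degree d. *)
Definition homogenize (d : nat) (p : {mpoly K[n]}) : {mpoly K[n.+1]} :=
  \sum_(m <- msupp p)
     mcoeff m p *:
       (mvar ord_max ^+ (d - mdeg m) *
        \prod_(i < n) mvar (affine i) ^+ m i).

(* The form of degree 2n-2 whose zero scheme is the singular variety. *)
Definition singular_form (Q : 'I_n.+1 * 'I_n.+1 -> 'I_n.+1 * 'I_n.+1 -> K) :
    {mpoly K[n.+1]} :=
  homogenize (2 * n - 2) (\det (monge_metric Q)).

End Complex.

(* Main.v *)
(* Contract the last index of c_{mnk} with a vector w to get matrices C(w).  The
   Hamiltonian equations then read D_w g = -(C(w) + C(w)^T) and
   D_w C(z) = -C(w)^T g^-1 C(z), and they imply that B(y, z) = C(y)^T g^-1 C(z)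
   has zero derivative, hence is constant.  So C is affine and g is quadratic in
   x = u - u0; completing the square, g = Phi^T g(u0) Phi where
   Phi = 1 - g(u0)^-1 C_{u0}(x) is affine.  As c_{mnk} is skew in n and k, the
   rows of Phi are combinations of the Pluecker forms p^{ab}, so g is a Monge
   metric and det g = det g(u0) (det Phi)^2.  The Pluecker forms have degree at
   most 1 after contraction with the Euler field, which brings the degree of
   det Phi from n down to n - 1. *)
From HB Require Import structures.
Require Import Defs.
From mathcomp Require Import all_boot all_order all_algebra.
From mathcomp Require Import perm complex.
From mathcomp Require Import boolp classical_sets reals topology normedtype derive.
From mathcomp Require Import -(notations) ssrcomplements mpoly.
From mathcomp Require Import ring.
Import numFieldNormedType.Exports.
Local Open Scope classical_set_scope.
Local Open Scope ring_scope.

Set Implicit Arguments.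
Unset Strict Implicit.
Unset Printing Implicit Defensive.

Import Order.TTheory GRing.Theory Num.Theory.

(** * Degree bounds for multivariate polynomials *)

Section Degree.
Variables (K : idomainType) (n : nat).
Implicit Types (p q : {mpoly K[n]}) (d e : nat).

(** [mmeasure mdeg] is the degree plus one, and 0 on the zero polynomial; hence the shift [d.+1]. *)
Definition deg_le d p := (mmeasure mdeg p <= d.+1)%N.

Lemma deg_leP d p : reflect (forall m, m \in msupp p -> mdeg m <= d)%N (deg_le d p).
Proof.
rewrite /deg_le mmeasureE; apply: (iffP (bigmax_leqP_seq _ _ _ _)) => h m mp.
  exact: (h m mp isT).
by move=> _; apply: h.
Qed.

Lemma deg_le0 d : deg_le d 0.
Proof. by rewrite /deg_le mmeasure0. Qed.

Lemma deg_leC d c : deg_le d (mpolyC n c).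
Proof. by rewrite /deg_le mmeasureC; case: (c != 0). Qed.

Lemma deg_leX d i : (0 < d)%N -> deg_le d (mvar i).
Proof. by move=> d0; rewrite /deg_le mmeasureX /= mdeg1. Qed.

Lemma deg_leN d p : deg_le d p -> deg_le d (- p).
Proof. by rewrite /deg_le mmeasureN. Qed.

Lemma deg_leD d p q : deg_le d p -> deg_le d q -> deg_le d (p + q).
Proof.
move=> hp hq; apply: leq_trans (mmeasureD_le _ _ _) _.
by rewrite geq_max; apply/andP.
Qed.

Lemma deg_leZ d c p : deg_le d p -> deg_le d (c *: p).
Proof. exact: leq_trans (mmeasureZ_le _ _ _). Qed.

Lemma deg_le_sum d (I : Type) (r : seq I) (P : pred I) (F : I -> {mpoly K[n]}) :
  (forall i, P i -> deg_le d (F i)) -> deg_le d (\sum_(i <- r | P i) F i).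
Proof. move=> hF; apply: (big_ind (deg_le d)) => //; first exact: deg_le0.
exact: deg_leD. Qed.

Lemma deg_leM d e p q : deg_le d p -> deg_le e q -> deg_le (d + e) (p * q).
Proof.
move=> hp hq.
have [->|p0] := eqVneq p 0; first by rewrite mul0r deg_le0.
have [->|q0] := eqVneq q 0; first by rewrite mulr0 deg_le0.
rewrite /deg_le msizeM // -subn1 leq_subLR add1n.
by apply: leq_trans (leq_add hp hq) _; rewrite addSn addnS.
Qed.

Lemma deg_le_prod (I : finType) (F : I -> {mpoly K[n]}) :
  (forall i, deg_le 1 (F i)) -> deg_le #|I| (\prod_i F i).
Proof.
(* With [#|I|] written as a sum of ones, the product and its bound grow together. *)
move=> hF; rewrite -sum1_card.
apply: (big_ind2 (fun p d => deg_le d p)) => //; first exact: deg_leC.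
by move=> *; exact: deg_leM.
Qed.

Lemma deg_le_det m (A : 'M[{mpoly K[n]}]_m) :
  (forall i j, deg_le 1 (A i j)) -> deg_le m (\det A).
Proof.
move=> hA; apply: deg_le_sum => s _.
have h : deg_le m (\prod_i A i (s i)).
  by rewrite -[X in deg_le X](card_ord m); apply: deg_le_prod => i; apply: hA.
by case: (odd_perm s); rewrite ?mul1r // mulN1r; exact: deg_leN.
Qed.

(** Degrees add over an integral domain, so cancelling a variable lowers the degree by exactly
    one. *)
Lemma deg_le_mulX d i p : deg_le d.+1 (mvar i * p) -> deg_le d p.
Proof.
have [->|p0] := eqVneq p 0; first by rewrite deg_le0.
have X0 : mvar i != 0 :> {mpoly K[n]}.
  by rewrite -(mmeasure_poly_eq0 mdeg) mmeasureX.
by rewrite /deg_le msizeM // mmeasureX /= mdeg1.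
Qed.
End Degree.

(** * Homogenization: linearity, multiplicativity, homogeneity *)

Section Homogenize.
Variables (K : numFieldType) (n : nat).
Implicit Types (p q : {mpoly K[n]}) (d e : nat).

Definition hmonom d (m : multinom n) : {mpoly K[n.+1]} :=
  mvar ord_max ^+ (d - mdeg m) * \prod_(i < n) mvar (affine i) ^+ m i.

(** The index set no longer depends on the support of [p], so that sums for different polynomials
    can be added termwise. *)
Lemma homogenizewE d k p : (mmeasure mdeg p <= k)%N ->
  homogenize d p = \sum_(m : bmultinom n k) mcoeff m p *: hmonom d m.
Proof.
move=> lt_pk; rewrite /homogenize (big_mksub (bmultinom n k)) /=; first last.
- by move=> m /mmeasure_mnm_lt /leq_trans; apply.
- exact: msupp_uniq.
by rewrite big_rmcond //= => i /memN_msupp_eq0 ->; rewrite scale0r.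
Qed.

Lemma homogenize_is_linear d : linear (@homogenize K n d).
Proof.
move=> c p q.
set k := maxn (mmeasure mdeg (c *: p + q))
  (maxn (mmeasure mdeg p) (mmeasure mdeg q)).
rewrite !(@homogenizewE d k) ?leq_max ?leqnn ?orbT //.
rewrite scaler_sumr -big_split /=; apply: eq_bigr => m _.
by rewrite linearP /= scalerDl scalerA.
Qed.

HB.instance Definition _ d :=
  GRing.isLinear.Build K {mpoly K[n]} {mpoly K[n.+1]} _ (@homogenize K n d)
    (@homogenize_is_linear d).

Lemma homogenizeX d m : homogenize d (mpolyX K m) = hmonom d m.
Proof. by rewrite /homogenize msuppX big_seq1 mcoeffX eqxx scale1r. Qed.

(** The bounds keep the truncated subtractions exact, so the exponents of u^{n+1} add up. *)
Lemma hmonomD d e m1 m2 : (mdeg m1 <= d)%N -> (mdeg m2 <= e)%N ->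
  hmonom (d + e) (mnm_add m1 m2) = hmonom d m1 * hmonom e m2.
Proof.
move=> h1 h2; rewrite /hmonom mdegD mulrACA -exprD; congr (_ ^+ _ * _).
  by rewrite subnDA addnC addnBA // [(e + d)%N]addnC addnBAC.
by rewrite -big_split /=; apply: eq_bigr => i _; rewrite mnmDE exprD.
Qed.

Lemma homogenizeM d e p q : deg_le d p -> deg_le e q ->
  homogenize (d + e) (p * q) = homogenize d p * homogenize e q.
Proof.
move=> /deg_leP hp /deg_leP hq.
rewrite {1}[p]mpolyE {1}[q]mpolyE mulr_suml linear_sum /= [in RHS]/homogenize.
rewrite mulr_suml big_seq [RHS]big_seq; apply: eq_bigr => m1 hm1.
rewrite -/(hmonom _ _) mulr_sumr linear_sum mulr_sumr.
rewrite big_seq [RHS]big_seq; apply: eq_bigr => m2 hm2.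
rewrite -/(hmonom _ _) -scalerAl -scalerAr scalerA linearZ /= -mpolyXD homogenizeX.
by rewrite hmonomD ?hp ?hq // -scalerAl -scalerAr scalerA.
Qed.

Lemma hmonom_homog d m : (mdeg m <= d)%N -> homogeneous d (hmonom d m).
Proof.
move=> hm.
have hX (i : 'I_n.+1) k : homogeneous k (mvar i ^+ k : {mpoly K[n.+1]}).
  rewrite -[X in ishomog1 X]mul1n; apply: dhomogMn.
  by rewrite dhomogX /= mdeg1.
have hP : homogeneous (mdeg m) (\prod_(i < n) mvar (affine i) ^+ m i : {mpoly K[n.+1]}).
  rewrite mdegE; apply: (big_ind2 (fun d (p : {mpoly K[n.+1]}) => homogeneous d p)) => //.
  - exact: dhomog1.
  - by move=> *; apply: dhomogM.
by have := dhomogM (hX ord_max (d - mdeg m)%N) hP; rewrite subnK.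
Qed.

Lemma homogenize_homog d p : deg_le d p -> homogeneous d (homogenize d p).
Proof.
move=> /deg_leP hp; rewrite /homogenize big_seq; apply: rpred_sum => m hm.
exact/rpredZ/hmonom_homog/hp.
Qed.

End Homogenize.

(** * Plücker forms and the Monge metrics built from them *)

Section Plucker.
Variables (K : numFieldType) (n : nat).
Local Notation index := ('I_n.+1 * 'I_n.+1)%type.

Lemma affine_coord_affine (i : 'I_n) : affine_coord K (affine i) = mvar i.
Proof. by rewrite /affine_coord liftK. Qed.

Lemma affine_coord_max : affine_coord K (@ord_max n) = 1.
Proof. by rewrite /affine_coord unlift_none. Qed.

Lemma deg_le_affine_coord (a : 'I_n.+1) : deg_le 1 (affine_coord K a).
Proof.
rewrite /affine_coord; case: unlift => [i|]; first exact: deg_leX.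
exact: deg_leC.
Qed.

Lemma deg_le_plucker s i : deg_le 1 (@plucker K n s i).
Proof.
by rewrite /plucker !mulr_natr; apply: deg_leD; [|apply: deg_leN];
  case: eqP => _; rewrite ?deg_le0 ?deg_le_affine_coord.
Qed.

(* [p^{ab}] contracted with the Euler field [u^i d/du^i] has degree at most 1,
   the quadratic terms cancelling. *)
Lemma plucker_euler (a b : 'I_n.+1) :
  \sum_(i < n) plucker K (a, b) i * mvar i =
  affine_coord K b * (a == ord_max)%:R - affine_coord K a * (b == ord_max)%:R.
Proof.
(* The contraction of du^e with the Euler field: u^e for an affine index, and 1 - 1 = 0 for the
   index n+1. *)
have E (e : 'I_n.+1) : \sum_(i < n) (e == affine i)%:R * mvar i =
    affine_coord K e - (e == ord_max)%:R.
  rewrite /affine_coord; case: unliftP => [j ->|->].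
    rewrite (bigD1 j) //= eqxx mul1r big1 ?addr0.
      by rewrite eq_sym (negPf (neq_lift _ _)) subr0.
    by move=> i ij; rewrite (inj_eq (@lift_inj _ _)) eq_sym (negPf ij) mul0r.
  rewrite eqxx subrr big1 // => i _.
  by rewrite (negPf (neq_lift _ _)) mul0r.
under eq_bigr => i _ do rewrite /plucker /= mulrBl -!mulrA.
rewrite sumrB -!mulr_sumr !E; ring.
Qed.

Definition frame (L : 'I_n -> index -> K) : 'M[{mpoly K[n]}]_n :=
  \matrix_(q, i) \sum_s L q s *: plucker K s i.

(* [p^{n+1,i} = du^i] and [p^{ki} = u^k du^i - u^i du^k]: the affine 1-forms
   [omega_i du^i + psi_{ik} u^k du^i], [psi] skew, are spanned by the [p^{ab}]. *)
Definition plucker_coef (omega : 'M[K]_n) (psi : 'I_n -> 'I_n -> 'I_n -> K)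
    (q : 'I_n) (s : index) : K :=
  match unlift ord_max s.1, unlift ord_max s.2 with
  | None, Some i => omega q i
  | Some k, Some i => 2^-1 * psi q i k
  | _, _ => 0
  end.

(** The pairs (n+1, i) give the constant part. Each affine pair occurs in both orders with equal
    contributions, whence the factor 1/2 in [plucker_coef]. *)
Lemma frame_plucker_coef omega psi q i :
  (forall q i k, psi q i k = - psi q k i) ->
  frame (plucker_coef omega psi) q i =
  mpolyC n (omega q i) + \sum_k psi q i k *: mvar k.
Proof.
move=> skew; rewrite mxE.
transitivity (\sum_a \sum_b plucker_coef omega psi q (a, b) *: plucker K (a, b) i).
  by rewrite pair_bigA; apply: eq_bigr => -[].
rewrite (bigD1_ord ord_max) //= (bigD1_ord ord_max) //=.
have E (a b : 'I_n) : (affine a == affine b) = (a == b).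
  exact: (inj_eq (@lift_inj _ _)).
have F (b : 'I_n) : (ord_max == affine b) = false.
  exact/negbTE/neq_lift.
rewrite /plucker_coef /= !unlift_none scale0r add0r; congr (_ + _).
  rewrite (bigD1 i) //= big1 => [|b bi].
    rewrite liftK /plucker /= -/(affine i) affine_coord_max eqxx F.
    by rewrite mulr0 subr0 mulr1 addr0 -mul_mpolyC mulr1.
  rewrite /plucker /= -/(affine b) E F (negPf bi) !mulr0 subrr.
  by rewrite scaler0.
(* [G a b] is the u^a du^b half of the term at (a, b); as [psi] is skew, the other half is
   [G b a]. *)
pose G a b := (2^-1 * psi q b a) *: (mvar a * (b == i)%:R : {mpoly K[n]}).
transitivity (\sum_a \sum_b (G a b + G b a)).
  apply: eq_bigr => a _; rewrite (bigD1_ord ord_max) //= liftK unlift_none.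
  rewrite scale0r add0r; apply: eq_bigr => b _; rewrite liftK /G.
  rewrite [psi q a b]skew /plucker /= -/(affine a) -/(affine b).
  by rewrite !affine_coord_affine !E mulrN scaleNr scalerBr.
rewrite (eq_bigr (fun a => \sum_b G a b + \sum_b G b a)); last first.
  by move=> a _; rewrite big_split.
rewrite big_split /= [X in _ + X]exchange_big /= -big_split /=.
apply: eq_bigr => k _; rewrite (bigD1 i) //= big1 ?addr0 => [|b bi].
  rewrite /G eqxx mulr1 -scalerDl -mulrDl.
  suff -> : 2^-1 + 2^-1 = 1 :> K by rewrite mul1r.
  by rewrite [RHS]splitr mul1r.
by rewrite /G (negPf bi) mulr0 scaler0.
Qed.

(** The form Q is the pullback of [eta] along [L]; both sides expand to the same fourfold sum. *)
Lemma monge_metric_frame L (eta : 'M[K]_n) :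
  monge_metric (fun s t => \sum_q \sum_r L q s * eta q r * L r t) =
  (frame L)^T *m map_mx (@mpolyC n K) eta *m frame L.
Proof.
apply/matrixP => i j; rewrite !mxE.
pose F s t q r := (L q s * eta q r * L r t) *: (plucker K s i * plucker K t j).
transitivity (\sum_s \sum_t \sum_q \sum_r F s t q r).
  by do 2!apply: eq_bigr => ? _; rewrite scaler_suml;
    apply: eq_bigr => ? _; rewrite scaler_suml.
transitivity (\sum_q \sum_r \sum_s \sum_t F s t q r).
  rewrite pair_bigA [RHS]pair_bigA /=.
  under eq_bigr => s _ do rewrite pair_bigA.
  by rewrite exchange_big; apply: eq_bigr => s _; rewrite pair_bigA.
rewrite exchange_big /=; apply: eq_bigr => r _.
rewrite !mxE mulr_suml; apply: eq_bigr => q _.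
rewrite !mxE !mulr_suml; apply: eq_bigr => s _.
rewrite mulr_sumr; apply: eq_bigr => t _.
rewrite /F -!mul_mpolyC !mpolyCM; ring.
Qed.

(* With x the Euler field, [frame L *m x] has degree at most 1; multiplying it by
   the adjugate, of degree n-1, gives [u^i \det (frame L)], which therefore has
   degree at most n. *)
Lemma deg_le_det_frame L : (0 < n)%N -> deg_le (n - 1) (\det (frame L)).
Proof.
move=> n0; set A := frame L; pose i0 := Ordinal n0.
have hA i j : deg_le 1 (A i j).
  by rewrite mxE; apply: deg_le_sum => s _; apply/deg_leZ/deg_le_plucker.
pose x : 'cV[{mpoly K[n]}]_n := \col_(i < n) mvar i.
have hx q : deg_le 1 ((A *m x) q 0).
  rewrite mxE; under eq_bigr => i _ do rewrite !mxE mulr_suml.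
  rewrite exchange_big /=; apply: deg_le_sum => -[a b] _.
  under eq_bigr => i _ do rewrite -scalerAl.
  rewrite -scaler_sumr; apply: deg_leZ; rewrite plucker_euler !mulr_natr.
  by apply: deg_leD; [|apply: deg_leN];
    case: eqP => _; rewrite ?deg_le0 ?deg_le_affine_coord.
apply: (@deg_le_mulX _ _ _ i0).
have -> : mvar i0 * \det A = (\adj A *m (A *m x)) i0 0.
  by rewrite mulmxA mul_adj_mx mul_scalar_mx !mxE mulrC.
rewrite mxE -addn1; apply: deg_le_sum => q _; apply: deg_leM => //.
rewrite mxE /cofactor -signr_odd mulr_sign subn1.
have h : deg_le n.-1 (\det (row' q (col' i0 A))).
  by apply: deg_le_det => i j; rewrite 2!mxE; exact: hA.
by case: odd; [apply: deg_leN|].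
Qed.

End Plucker.

(** * Directional derivatives of scalar functions *)

Section PointwiseDerivative.
Variables (K : numFieldType) (V : normedModType K).
Implicit Types (f g : V -> K) (x v : V).

Lemma is_derive_val f x v df df' : is_derive x v f df -> df = df' -> is_derive x v f df'.
Proof. by move=> ? <-. Qed.

Lemma is_derive_mul f g x v df dg : is_derive x v f df -> is_derive x v g dg ->
  is_derive x v (fun y => f y * g y) (df * g x + f x * dg).
Proof.
move=> hf hg; apply: is_derive_val (is_deriveM hf hg) _.
by rewrite /GRing.scale /= addrC [df * _]mulrC.
Qed.

Lemma is_derive_bigsum (I : Type) (r : seq I) (F : I -> V -> K) (dF : I -> K) x v :
  (forall i, is_derive x v (F i) (dF i)) ->
  is_derive x v (fun y => \sum_(i <- r) F i y) (\sum_(i <- r) dF i).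
Proof.
move=> h; elim: r => [|i r IH].
  by rewrite big_nil; under eq_fun do rewrite big_nil; exact: is_derive_cst.
rewrite big_cons; under eq_fun do rewrite big_cons; exact: is_deriveD.
Qed.

Lemma derivable_bigprod (I : Type) (r : seq I) (F : I -> V -> K) x v :
  (forall i, derivable (F i) x v) -> derivable (fun y => \prod_(i <- r) F i y) x v.
Proof.
move=> h; elim: r => [|i r IH].
  by under eq_fun do rewrite big_nil; exact: derivable_cst.
by under eq_fun do rewrite big_cons; exact: derivableM.
Qed.

Lemma derivable_bigsum (I : Type) (r : seq I) (F : I -> V -> K) x v :
  (forall i, derivable (F i) x v) -> derivable (fun y => \sum_(i <- r) F i y) x v.
Proof.
move=> h; have d i := derivableP (h i).
exact: (@ex_derive _ _ _ _ _ _ _ (is_derive_bigsum r d)).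
Qed.

Lemma derivable_det m (A : V -> 'M[K]_m) x v :
  (forall i j, derivable (fun y => A y i j) x v) -> derivable (fun y => \det (A y)) x v.
Proof.
move=> h; apply: derivable_bigsum => s.
by apply: derivableM; [exact: derivable_cst|exact: derivable_bigprod].
Qed.

(** By Cramer's rule the inverse is the adjugate over the determinant. Invertibility is asked near
    [x] because [invmx] returns a singular matrix unchanged. *)
Lemma derivable_invmx m (A : V -> 'M[K]_m) x v i j :
  (\forall y \near x, A y \in unitmx) ->
  (forall i j, derivable (fun y => A y i j) x v) ->
  derivable (fun y => invmx (A y) i j) x v.
Proof.
move=> hu h.
have : derivable (fun y => (\det (A y))^-1 * cofactor (A y) j i) x v.
  apply: derivableM.
    apply: derivableV; last exact: derivable_det.
    by have := nbhs_singleton hu; rewrite unitmxE unitfE.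
  apply: derivableM; first exact: derivable_cst.
  apply: derivable_det => k l.
  by under eq_fun do rewrite !mxE; exact: h.
apply: near_eq_derivable; near=> y.
have hy : A y \in unitmx by near: y.
by rewrite /invmx hy !mxE.
Unshelve. all: by end_near. Qed.

End PointwiseDerivative.

(** * Polynomials as functions: derivatives and vanishing on open sets *)

Section PolynomialFunctions.
Variables (K : numFieldType) (n : nat).
Implicit Types (p q : {mpoly K[n]}) (u v w : 'rV[K]_n).

Lemma is_derive_coord u w (j : 'I_n) : is_derive u w (fun v => v 0 j) (w 0 j).
Proof.
apply: DeriveDef; first exact/diff_derivable/differentiable_coord.
have lin : linear (fun v : 'rV[K]_n => v 0 j : K^o) by move=> c x y; rewrite !mxE.
pose f : {linear 'rV[K]_n -> K} := HB.pack (fun v : 'rV[K]_n => v 0 j)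
  (GRing.isLinear.Build K 'rV[K]_n K _ _ lin).
rewrite deriveE; last exact: differentiable_coord.
rewrite -[LHS]/('d f u w) diff_lin //; exact: coord_continuous.
Qed.

Lemma is_derive_meval p u i :
  is_derive u (delta_mx 0 i) (fun v => meval (fun j => v 0 j) p)
            (meval (fun j => u 0 j) (mderiv i p)).
Proof.
elim/mpolyind: p u i => [|c m p _ _ IH] u i.
  rewrite mderiv0 meval0; under eq_fun do rewrite meval0.
  exact: is_derive_cst.
rewrite mderivD mderivZ mevalD mevalZ; under eq_fun do rewrite mevalD mevalZ.
apply: is_deriveD; apply: is_deriveZ; move: u i {IH p}.
(* A monomial is a product of powers of variables, so the Leibniz rule and the case of one power
   suffice. *)
rewrite mpolyXE_id; apply: (big_ind (fun p => forall u i,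
  is_derive u (delta_mx 0 i) (fun v => meval (fun j => v 0 j) p)
            (meval (fun j => u 0 j) (mderiv i p)))).
- move=> u i; rewrite -mpolyC1 mderivC meval0; under eq_fun do rewrite mevalC.
  exact: is_derive_cst.
- move=> p q hp hq u i; rewrite mderivM mevalD !mevalM.
  under eq_fun do rewrite mevalM.
  exact: is_derive_val (is_derive_mul (hp u i) (hq u i)) _.
move=> j _; elim: (m j) => [|k IH] u i.
  rewrite expr0 -mpolyC1 mderivC meval0; under eq_fun do rewrite mevalC.
  exact: is_derive_cst.
rewrite exprS mderivM mevalD !mevalM; under eq_fun do rewrite mevalM.
apply: is_derive_mul (IH u i).
under eq_fun do rewrite mevalXU.
apply: is_derive_val (is_derive_coord _ _ _) _.
rewrite mxE eqxx mderivX mevalZ mnm1E eq_sym.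
case: eqP => [->|_]; rewrite ?mul0r // mul1r.
have -> : mnm_sub (mnm1 j) (mnm1 j) = mnm0 by apply/mnmP => l; rewrite mnmBE subnn mnm0E.
by rewrite mpolyX0 meval1.
Qed.

(** Induction on the degree: the partial derivatives vanish on [U] too, hence are zero polynomials,
    and [p] is constant. *)
Lemma meval_open_eq0 (U : set 'rV[K]_n) p : open U -> U !=set0 ->
  (forall u, U u -> meval (fun j => u 0 j) p = 0) -> p = 0.
Proof.
move=> oU U0; have [d] := ubnPleq (mmeasure mdeg p); elim: d p => [|d IH] p hd hp.
  by apply/eqP; rewrite -(mmeasure_poly_eq0 mdeg) -leqn0.
have hder i : mderiv i p = 0.
  apply: IH => [|u Uu].
    rewrite mmeasureE; apply/bigmax_leqP_seq => m hm _; rewrite -ltnS.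
    apply: leq_trans hd; have -> : (mdeg m).+1 = mdeg (mnm_add m (mnm1 i)).
      by rewrite mdegD mdeg1 addn1.
    apply: mmeasure_mnm_lt; move: hm; rewrite !mcoeff_msupp mcoeff_mderiv.
    by apply: contra => /eqP ->; rewrite mul0rn.
  have [_ <-] := is_derive_meval p u i.
  have : is_derive u (delta_mx 0 i) (fun v => meval (fun j => v 0 j) p) 0.
    apply: near_eq_is_derive (is_derive_cst 0 _ _).
    by near=> v; rewrite hp //; near: v; exact: open_nbhs_nbhs.
  by move=> [].
have hpC : p = mpolyC n (mcoeff mnm0 p).
  apply/mpolyP => m; rewrite mcoeffC.
  have [->|/eqP m0] := eqVneq m mnm0; first by rewrite mulr1.
  have [i hi] : exists i, (0 < m i)%N.
    apply/existsP; apply: contra_notT m0; rewrite negb_exists => /forallP h.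
    by apply/mnmP => i; rewrite mnm0E; apply/eqP; rewrite -leqn0 leqNgt.
  (* This coefficient of the i-th derivative is [m i] times that of [m] in [p]; characteristic zero
     allows division by [m i]. *)
  have := congr1 (mcoeff (mnm_sub m (mnm1 i))) (hder i).
  rewrite mcoeff_mderiv mcoeff0 submK ?lep1mP -?lt0n //.
  by move/eqP; rewrite mulrn_eq0 /= mulr0 => /eqP.
have [u Uu] := U0; move: (hp u Uu); rewrite hpC mevalC => ->.
by rewrite mpolyC0.
Unshelve. all: by end_near. Qed.
End PolynomialFunctions.

(** * Functions with zero derivative on a connected open set *)

Section ZeroDerivative.

Lemma is_derive_cvg0 (K : numFieldType) (V W : normedModType K) (f : V -> W) a v :
  is_derive a v f 0 <->
  (h^-1 *: ((f \o shift a) (h *: v) - f a)) @[h --> 0^'] --> (0 : W).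
Proof.
split=> [[df <-] //|h0].
by apply: DeriveDef; [apply/cvg_ex; exists 0|exact: cvg_lim].
Qed.

Lemma zero_derive_segment_real (R : realType) (h : R -> R) :
  (forall t : R, 0 <= t <= 1 -> is_derive t 1 h 0) -> h 1 = h 0.
Proof.
move=> hh; apply/eqP; rewrite -subr_eq0; apply/eqP.
have [t ht||c _ ->] := @MVT_segment R h (fun=> 0) 0 1 ler01.
- by apply: hh; move: ht; rewrite in_itv /= => /andP[/ltW -> /ltW].
- apply: derivable_within_continuous => t; rewrite in_itv /= => ht.
  by have [] := hh t ht.
- by rewrite mul0r.
Qed.

(* [iota] embeds the reals in K and [pi] is the real or the imaginary part. *)
Section Projection.
Variables (R : realType) (K : numFieldType) (iota : {rmorphism R -> K}).
Hypothesis norm_iota : forall t, `|iota t| = iota `|t|.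
Hypothesis iota_le : {mono iota : s t / s <= t}.
Hypothesis iota_cofinal : forall d : K, 0 < d -> exists2 t : R, 0 < t & iota t <= d.
Variable pi : K -> R.
Hypothesis piB : {morph pi : x y / x - y}.
Hypothesis piM : forall t z, pi (iota t * z) = t * pi z.
Hypothesis norm_pi : forall z, iota `|pi z| <= `|z|.

(** Restricted to real parameters, [pi] of [f] has as difference quotients the images under [pi] of
    those of [f]. As [pi] does not increase norms, they tend to 0 and the real case applies. *)
Lemma zero_derive_segment_proj (V : normedModType K) (f : V -> K) (a w : V) :
  (forall t : K, 0 <= t <= 1 -> is_derive (a + t *: w) w f 0) ->
  pi (f (a + w)) = pi (f a).
Proof.
move=> hf; pose h t := pi (f (a + iota t *: w)).
suff : h 1 = h 0 by rewrite /h rmorph1 rmorph0 scale1r scale0r addr0.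
have iota_lt : {mono iota : s t / s < t} := leW_mono iota_le.
apply: zero_derive_segment_real => t /andP[t0 t1].
have /is_derive_cvg0 /cvgr0Pnorm_lt hK : is_derive (a + iota t *: w) w f 0.
  by apply: hf; rewrite -[0](rmorph0 iota) -[1](rmorph1 iota) !iota_le t0.
apply/is_derive_cvg0/cvgr0Pnorm_lt => e e0.
have /hK [d /= d0 hd] : 0 < iota e by rewrite -(rmorph0 iota) iota_lt.
(* The radius [d] lies in K; a real radius below it is needed. *)
have [d' d'0 dd'] := iota_cofinal d0.
exists d' => //= s; rewrite /ball_ /= sub0r normrN => sd s0.
have {hd} : `|(iota s)^-1 *: ((f \o shift (a + iota t *: w)) (iota s *: w)
    - f (a + iota t *: w))| < iota e.
  apply: hd; rewrite ?fmorph_eq0 // /ball_ /= sub0r normrN norm_iota.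
  by apply: lt_le_trans dd'; rewrite iota_lt.
rewrite -[_ < e]iota_lt; apply: le_lt_trans; apply: le_trans (norm_pi _).
rewrite /GRing.scale /= -fmorphV piM iota_le piB /h /= mulr1 rmorphD scalerDl.
by rewrite [a + (_ + _)]addrCA.
Qed.
End Projection.

(** In the order of the complex numbers [0 <= t <= 1] forces [t] to be real, so the hypothesis
    concerns a real segment in both cases. *)
Lemma zero_derive_segment (R : realType) (K : numFieldType) :
  K = (R : numFieldType) \/ K = (complex R : numFieldType) ->
  forall (V : normedModType K) (f : V -> K) (a w : V),
  (forall t : K, 0 <= t <= 1 -> is_derive (a + t *: w) w f 0) -> f (a + w) = f a.
Proof.
case=> ->{K} V f a w hf.
  by apply: (@zero_derive_segment_proj R R idfun _ _ _ idfun) hf => // d; exists d.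
have norm_iota (t : R) : `|real_complex R t| = real_complex R `|t|.
  by rewrite normc_def /= expr0n addr0 sqrtr_sqr.
have cofinal (d : complex R) : 0 < d -> exists2 t : R, 0 < t & real_complex R t <= d.
  by case: d => x y; rewrite ltcE /= => /andP[/eqP -> x0]; exists x.
have proj (pi : complex R -> R) :=
  zero_derive_segment_proj norm_iota (@lecR R) cofinal (pi := pi).
apply/eqP; rewrite eq_complex; apply/andP; split; apply/eqP.
- apply: (proj (@complex.Re R)) hf => [[x y] [z t]|t [x y]|z] //=.
    by rewrite mul0r subr0.
  exact: normc_ge_Re.
- apply: (proj (@complex.Im R)) hf => [[x y] [z t]|t [x y]|[x y]] //=.
    by rewrite mul0r addr0.
  (* The imaginary part of z is the real part of -iz. *)
  have := normc_ge_Re (Complex y (- x)).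
  by rewrite /= !normc_def /= sqrrN addrC.
Qed.

(** By [loc], [f] is constant on small balls, which contain the segments from their centre; so its
    level sets are open and closed in [U]. *)
Lemma zero_derive_constant (R : realType) (K : numFieldType) (n : nat)
    (U : set 'rV[K]_n) (f : 'rV[K]_n -> K) :
  K = (R : numFieldType) \/ K = (complex R : numFieldType) ->
  open U -> connected U ->
  (forall u w, U u -> is_derive u w f 0) ->
  forall u v, U u -> U v -> f u = f v.
Proof.
move=> hK oU cU hf u0 v0 Uu0 Uv0.
have loc u : U u -> \forall v \near u, U v /\ f v = f u.
  move=> Uu; have /nbhs_normP [e /= e0 he] := open_nbhs_nbhs (conj oU Uu).
  apply/nbhs_normP; exists e => //= v huv; split; first exact: he.
  have -> : v = u + (v - u) by rewrite addrC subrK.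
  apply: (zero_derive_segment hK) => t /andP[t0 t1]; apply: hf; apply: he => /=.
  rewrite opprD addNKr normrN normrZ ger0_norm //.
  apply: le_lt_trans huv; rewrite -normrN opprB; exact: ler_piMl.
have -> // : f u0 = f v0.
suff : [set u | U u /\ f u = f u0] = U by move=> /[dup] E; rewrite -E in Uv0; case: Uv0.
apply: cU; first by exists u0.
- exists [set u | U u /\ f u = f u0]; last by apply/seteqP; split=> u; case.
  by rewrite openE => u [/loc h fu]; apply: filterS h => v [Uv fv] /=; rewrite fv.
- exists (~` [set u | U u /\ f u != f u0]).
    apply: open_closedC; rewrite openE => u [/loc h fu].
    by apply: filterS h => v [Uv fv] /=; rewrite fv.
  apply/seteqP; split=> u [Uu h]; split=> //; first by case=> _; rewrite h eqxx.
  by apply/eqP/negPn/negP => fu; apply: h.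
Qed.

End ZeroDerivative.

(** * Entrywise derivatives of matrix-valued functions *)

Section MatrixDerivative.
Variables (K : numFieldType) (V : normedModType K) (u w : V).

Definition mx_derive p q (A : V -> 'M[K]_(p, q)) (dA : 'M[K]_(p, q)) :=
  forall i j, is_derive u w (fun v => A v i j) (dA i j).

Lemma mx_derive_val p q (A : V -> 'M[K]_(p, q)) dA dA' :
  mx_derive A dA -> dA = dA' -> mx_derive A dA'.
Proof. by move=> ? <-. Qed.

Lemma mx_derive_unique p q (A : V -> 'M[K]_(p, q)) dA dA' :
  mx_derive A dA -> mx_derive A dA' -> dA = dA'.
Proof.
by move=> h h'; apply/matrixP => i j; have [_ <-] := h i j; have [_ <-] := h' i j.
Qed.

Lemma mx_derive_near p q (A B : V -> 'M[K]_(p, q)) dA :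
  (\near u, A u = B u) -> mx_derive A dA -> mx_derive B dA.
Proof.
move=> AB hA i j; apply: near_eq_is_derive (hA i j).
by apply: filterS AB => v ->.
Qed.

Lemma mx_derive_cst p q (A : 'M[K]_(p, q)) : mx_derive (fun=> A) 0.
Proof. by move=> i j; rewrite mxE; exact: is_derive_cst. Qed.

Lemma mx_derive_add p q (A B : V -> 'M[K]_(p, q)) dA dB :
  mx_derive A dA -> mx_derive B dB -> mx_derive (fun v => A v + B v) (dA + dB).
Proof.
move=> hA hB i j; rewrite mxE; under eq_fun do rewrite mxE.
exact: is_deriveD.
Qed.

Lemma mx_derive_opp p q (A : V -> 'M[K]_(p, q)) dA :
  mx_derive A dA -> mx_derive (fun v => - A v) (- dA).
Proof.
move=> hA i j; rewrite mxE; under eq_fun do rewrite mxE.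
exact: is_deriveN.
Qed.

Lemma mx_derive_tr p q (A : V -> 'M[K]_(p, q)) dA :
  mx_derive A dA -> mx_derive (fun v => (A v)^T) dA^T.
Proof. by move=> hA i j; rewrite mxE; under eq_fun do rewrite mxE; exact: hA. Qed.

Lemma mx_derive_mul p q r (A : V -> 'M[K]_(p, q)) (B : V -> 'M[K]_(q, r)) dA dB :
  mx_derive A dA -> mx_derive B dB ->
  mx_derive (fun v => A v *m B v) (dA *m B u + A u *m dB).
Proof.
move=> hA hB i j; rewrite !mxE -big_split /=.
under eq_fun do rewrite mxE.
by apply: is_derive_bigsum => k; exact: is_derive_mul.
Qed.

(** Once the inverse is known to be derivable, differentiating A A^-1 = 1 gives the value. *)
Lemma mx_derive_invmx p (A : V -> 'M[K]_p) dA :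
  (\forall v \near u, A v \in unitmx) -> mx_derive A dA ->
  mx_derive (fun v => invmx (A v)) (- (invmx (A u) *m dA *m invmx (A u))).
Proof.
move=> hu hA; pose X : 'M[K]_p := \matrix_(i, j) 'D_w (fun v => invmx (A v) i j) u.
have hX : mx_derive (fun v => invmx (A v)) X.
  move=> i j; rewrite mxE; apply/derivableP/derivable_invmx => // k l.
  by have [] := hA k l.
have Au := nbhs_singleton hu.
have : dA *m invmx (A u) + A u *m X = 0.
  apply: mx_derive_unique (mx_derive_mul hA hX) _.
  apply: mx_derive_near (mx_derive_cst 1%:M).
  by apply: filterS hu => v hv; rewrite mulmxV.
move/eqP; rewrite addrC addr_eq0 => /eqP /(congr1 (mulmx (invmx (A u)))).
by rewrite mulKmx // mulmxN mulmxA => <-.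
Qed.

End MatrixDerivative.

(** * Directional derivatives from partial derivatives *)

Section Gradient.
Variables (K : numFieldType) (n : nat).
Implicit Types (f : 'rV[K]_n -> K) (u w : 'rV[K]_n).

Lemma is_derive_pderiv f u w : differentiable f u ->
  is_derive u w f (\sum_k w 0 k * pderiv f k u).
Proof.
move=> df; apply: DeriveDef; first exact: diff_derivable.
rewrite deriveE // {1}(row_sum_delta w) linear_sum; apply: eq_bigr => k _.
by rewrite linearZ /= /pderiv deriveE.
Qed.

Lemma differentiable_bigsum (I : Type) (r : seq I) (F : I -> 'rV[K]_n -> K) u :
  (forall i, differentiable (F i) u) ->
  differentiable (fun v => \sum_(i <- r) F i v) u.
Proof.
move=> h; elim: r => [|i r IH].
  by under eq_fun do rewrite big_nil; exact: differentiable_cst.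
by under eq_fun do rewrite big_cons; exact: differentiableD.
Qed.

Lemma differentiable_lowerc U (g : 'rV[K]_n -> 'M[K]_n) c u i j k :
  hamiltonian U g c -> U u -> differentiable (lowerc g c i j k) u.
Proof.
move=> H Uu; apply: differentiable_bigsum => q; apply: differentiable_bigsum => p.
apply: differentiableM; last exact: coef_differentiable H _ Uu _ _ _.
by apply: differentiableM; apply: metric_differentiable H _ Uu _ _.
Qed.
End Gradient.

(** * Integration of the Hamiltonian equations *)

Section Hamiltonian.
Variables (R : realType) (K : numFieldType)
    (K_real_or_complex :
       K = (R : numFieldType) \/ K = (complex R : numFieldType)).
Variables (n : nat) (U : set 'rV[K]_n) (U_open : open U) (U_connected : connected U).
Variables (g : 'rV[K]_n -> 'M[K]_n) (c : 'I_n -> 'I_n -> 'I_n -> 'rV[K]_n -> K)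
    (H : hamiltonian U g c).
Implicit Types (u v w y z : 'rV[K]_n).

(* [cmx z u] is c_{ijk} z^k, and [curv y z u] is g^{pq} c_{pil} y^l c_{qjk} z^k,
   so that the last equation of [hamiltonian] reads D_w (cmx z) = - curv w z. *)
Definition cmx z u : 'M[K]_n := \matrix_(i, j) \sum_k z 0 k * lowerc g c i j k u.

Definition curv y z u : 'M[K]_n := (cmx y u)^T *m invmx (g u) *m cmx z u.

Lemma cmx0 u : cmx 0 u = 0.
Proof.
by apply/matrixP => i j; rewrite !mxE big1 // => k _; rewrite mxE mul0r.
Qed.

Lemma metric_tr u : U u -> (g u)^T = g u.
Proof. by move=> Uu; apply/matrixP => i j; rewrite mxE (metric_symmetric H). Qed.

Lemma metric_unit u : U u -> g u \in unitmx.
Proof. by move=> Uu; rewrite unitmxE unitfE (metric_nondegenerate H). Qed.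

Lemma invmetric_tr u : U u -> (invmx (g u))^T = invmx (g u).
Proof. by move=> Uu; rewrite trmx_inv metric_tr. Qed.

Lemma mx_derive_metric u w : U u -> mx_derive u w g (- (cmx w u + (cmx w u)^T)).
Proof.
move=> Uu i j; have hd := metric_differentiable H Uu i j.
apply: is_derive_val (is_derive_pderiv w hd) _.
rewrite !mxE -big_split /= -sumrN; apply: eq_bigr => k _.
by rewrite (metric_pderiv H) // -mulrDr -mulrN opprD.
Qed.

Lemma mx_derive_cmx u w z : U u -> mx_derive u w (cmx z) (- curv w z u).
Proof.
move=> Uu i j.
have hd k := is_derive_pderiv w (differentiable_lowerc i j k H Uu).
have -> : (fun v => cmx z v i j) = (fun v => \sum_k z 0 k * lowerc g c i j k v).
  by apply/funext => v; rewrite mxE.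
apply: is_derive_val (is_derive_bigsum _ (fun k =>
  is_derive_mul (is_derive_cst (z 0 k) u w) (hd k))) _.
(* The sums are reordered from k, l, p, q to q, p, l, k, the order in an entry of the triple matrix
   product. *)
pose F k l p q := - (z 0 k * w 0 l * (invmx (g u) p q *
  lowerc g c p i l u * lowerc g c q j k u)).
transitivity (\sum_k \sum_l \sum_p \sum_q F k l p q).
  apply: eq_bigr => k _; rewrite mul0r add0r mulr_sumr; apply: eq_bigr => l _.
  rewrite (lowerc_pderiv H) // mulrN mulrN mulrA mulr_sumr -sumrN.
  by apply: eq_bigr => p _; rewrite mulr_sumr -sumrN; apply: eq_bigr.
transitivity (\sum_p \sum_q \sum_k \sum_l F k l p q).
  rewrite pair_bigA [RHS]pair_bigA /=.
  under eq_bigr => s _ do rewrite pair_bigA.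
  by rewrite exchange_big; apply: eq_bigr => s _; rewrite pair_bigA.
rewrite exchange_big !mxE -sumrN; apply: eq_bigr => q _.
rewrite !mxE mulr_suml -sumrN; apply: eq_bigr => p _.
rewrite !mxE exchange_big !mulr_suml -sumrN; apply: eq_bigr => l _.
rewrite mulr_sumr -sumrN; apply: eq_bigr => k _.
by rewrite /F; ring.
Qed.

(** The outer factors contribute - C(y)^T g^-1 C(w) g^-1 C(z) and - C(y)^T g^-1 C(w)^T g^-1 C(z);
    the derivative of g^-1 contributes the same two terms with a plus sign. *)
Lemma mx_derive_curv u w y z : U u -> mx_derive u w (curv y z) 0.
Proof.
move=> Uu.
have hU : \forall v \near u, g v \in unitmx.
  by apply: filterS (open_nbhs_nbhs (conj U_open Uu)); exact: metric_unit.
have hG := mx_derive_invmx hU (mx_derive_metric w Uu).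
have hy := mx_derive_cmx w y Uu; have hz := mx_derive_cmx w z Uu.
apply: mx_derive_val (mx_derive_mul (mx_derive_mul (mx_derive_tr hy) hG) hz) _.
rewrite /curv linearN /= !trmx_mul trmxK invmetric_tr //.
rewrite !(mulmxDl, mulmxDr, mulNmx, mulmxN, opprK, mulmxA).
by rewrite addKr subrr.
Qed.

Lemma mx_derive_constant p q (A : 'rV[K]_n -> 'M[K]_(p, q)) :
  (forall u w, U u -> mx_derive u w A 0) -> forall u v, U u -> U v -> A u = A v.
Proof.
move=> hA u v Uu Uv; apply/matrixP => i j.
apply: (zero_derive_constant (f := fun v => A v i j)
  K_real_or_complex U_open U_connected _ Uu Uv).
by move=> x w Ux; have := hA x w Ux i j; rewrite mxE.
Qed.

Variables (u0 : 'rV[K]_n) (Uu0 : U u0).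

Lemma mx_derive_cmx_sub u w :
  mx_derive u w (fun v => cmx (v - u0) u0) (cmx w u0).
Proof.
move=> i j; rewrite mxE; under eq_fun do rewrite mxE.
apply: is_derive_bigsum => k; under eq_fun do rewrite !mxE.
have hk := is_derive_mul (is_deriveB (is_derive_coord u w k) (is_derive_cst (u0 0 k) u w))
  (is_derive_cst (lowerc g c i j k u0) u w).
by apply: is_derive_val hk _; rewrite subr0 mulr0 addr0.
Qed.

Lemma mx_derive_curv_sub u w z :
  mx_derive u w (fun v => curv (v - u0) z u0) (curv w z u0).
Proof.
have h := mx_derive_mul (mx_derive_mul (mx_derive_tr (mx_derive_cmx_sub u w))
  (mx_derive_cst u w (invmx (g u0)))) (mx_derive_cst u w (cmx z u0)).
by apply: mx_derive_val h _; rewrite !mulmx0 !addr0.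
Qed.

(** The derivative of [A] along w is B(w, z) at [u0] minus B(w, z) at the current point, and B is
    constant. *)
Lemma cmx_affine u z : U u -> cmx z u = cmx z u0 - curv (u - u0) z u0.
Proof.
move=> Uu; pose A v := cmx z v + curv (v - u0) z u0.
have AE : A u = A u0.
  apply: mx_derive_constant Uu Uu0 => v w Uv.
  have h := mx_derive_add (mx_derive_cmx w z Uv) (mx_derive_curv_sub v w z).
  apply: mx_derive_val h _; rewrite addrC; apply/eqP; rewrite subr_eq0; apply/eqP.
  by apply: mx_derive_constant Uu0 Uv => v' w' Uv'; exact: mx_derive_curv.
have -> : cmx z u = A u - curv (u - u0) z u0 by rewrite addrK.
by rewrite AE /A subrr /curv cmx0 trmx0 !mul0mx addr0.
Qed.

Lemma metric_quadratic u : U u ->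
  g u = g u0 - (cmx (u - u0) u0 + (cmx (u - u0) u0)^T) + curv (u - u0) (u - u0) u0.
Proof.
move=> Uu; pose C v := cmx (v - u0) u0.
pose A v := g v + (C v + (C v)^T) - curv (v - u0) (v - u0) u0.
have AE : A u = A u0.
  apply: mx_derive_constant Uu Uu0 => v w Uv.
  have hC := mx_derive_cmx_sub v w.
  have hcurv := mx_derive_mul (mx_derive_mul (mx_derive_tr hC)
    (mx_derive_cst v w (invmx (g u0)))) hC.
  have h := mx_derive_add (mx_derive_add (mx_derive_metric w Uv)
    (mx_derive_add hC (mx_derive_tr hC))) (mx_derive_opp hcurv).
  apply: mx_derive_val h _; rewrite (cmx_affine w Uv) /curv.
  rewrite linearB /= !trmx_mul trmxK invmetric_tr // mulmx0 addr0 !mulmxA.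
  (* With x = v - u0, [b] is B(x, w) and [e] its transpose; both arise from the affine form of C in
     the derivative of g and from the product rule on B(x, x). *)
  set a := cmx w u0; set b := _ *m a; set e := _ *m _ *m cmx (v - u0) u0.
  have -> : a - b + (a^T - e) = (a + a^T) - (e + b).
    by rewrite addrACA -opprD [b + e]addrC.
  by rewrite opprB subrK subrr.
have -> : g u = A u + curv (u - u0) (u - u0) u0 - (C u + (C u)^T) by rewrite subrK addrK.
by rewrite AE /A /C subrr /curv cmx0 trmx0 !mul0mx !addr0 subr0 addrAC.
Qed.

Lemma metric_frame u : U u ->
  let phi := 1%:M - invmx (g u0) *m cmx (u - u0) u0 in g u = phi^T *m g u0 *m phi.
Proof.
move=> Uu phi; rewrite (metric_quadratic Uu) /phi [(_ - _)^T]linearB /=.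
rewrite tr_scalar_mx trmx_mul.
rewrite invmetric_tr // mulmxBl mul1mx mulmxKV ?metric_unit //.
rewrite mulmxBr mulmx1 mulmxBl mulKVmx ?metric_unit // /curv mulmxA.
set b := _ *m cmx _ _; rewrite opprB opprD [b - _]addrC !addrA.
by congr (_ + _); exact: addrAC.
Qed.

(** Plücker coefficients of the rows of Phi: the base point [u0] is absorbed into the constant
    part. *)
Definition hamiltonian_coef := plucker_coef
  (\matrix_(q, i) ((q == i)%:R + \sum_k u0 0 k *
    \sum_p invmx (g u0) q p * lowerc g c p i k u0))
  (fun q i k => - \sum_p invmx (g u0) q p * lowerc g c p i k u0).

Lemma meval_frame_hamiltonian u :
  map_mx (meval (fun i => u 0 i)) (frame hamiltonian_coef) =
  1%:M - invmx (g u0) *m cmx (u - u0) u0.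
Proof.
(* The side condition is the skewness of c_{pik} in i and k. *)
apply/matrixP => q i; rewrite mxE frame_plucker_coef => [|q' i' k]; last first.
  congr (- _); rewrite -sumrN; apply: eq_bigr => p _.
  by rewrite -mulrN (lowerc_skew H).
rewrite mevalD mevalC !mxE -addrA; congr (_ + _).
rewrite raddf_sum /= -big_split /= -sumrN.
under [RHS]eq_bigr => p _ do rewrite mxE mulr_sumr -sumrN.
rewrite exchange_big; apply: eq_bigr => k _ /=; rewrite mevalZ mevalXU.
set S := \sum_p _; transitivity (- ((u - u0) 0 k * S)).
  by rewrite !mxE; ring.
rewrite mulr_sumr -sumrN; apply: eq_bigr => p _.
by rewrite mulrCA.
Qed.

Lemma is_monge_metric_hamiltonian : is_monge_metric_of U g
  (fun s t => \sum_q \sum_r hamiltonian_coef q s * g u0 q r * hamiltonian_coef r t).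
Proof.
split=> [s t|u Uu].
  rewrite exchange_big; apply: eq_bigr => r _; apply: eq_bigr => q _.
  by rewrite (metric_symmetric H Uu0); ring.
rewrite monge_metric_frame !map_mxM -map_trmx meval_frame_hamiltonian (metric_frame Uu).
congr (_ *m _ *m _); apply/matrixP => i j.
by rewrite !mxE /= mevalC.
Qed.

End Hamiltonian.

(** * The singular variety as a double hypersurface *)

(** The metric does not determine Q, because of p^{ab} = -p^{ba} and the quadratic Plücker
    relations, but it determines the polynomial matrix. This carries the result from one Q to
    all. *)
Lemma monge_metric_unique (K : numFieldType) (n : nat) (U : set 'rV[K]_n) g Q Q' :
  open U -> U !=set0 -> is_monge_metric_of U g Q -> is_monge_metric_of U g Q' ->
  monge_metric Q = monge_metric Q'.
Proof.
move=> oU U0 [_ hQ] [_ hQ']; apply/matrixP => i j; apply/eqP; rewrite -subr_eq0.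
apply/eqP/(meval_open_eq0 oU U0) => u Uu; rewrite mevalB.
have := hQ u Uu; rewrite (hQ' u Uu) => /matrixP/(_ i j); rewrite !mxE => ->.
by rewrite subrr.
Qed.

Lemma singular_form_frame (K : numFieldType) (n : nat) Q L (eta : 'M[K]_n) :
  (0 < n)%N ->
  monge_metric Q = (frame L)^T *m map_mx (@mpolyC n K) eta *m frame L ->
  singular_form Q = \det eta *: homogenize (n - 1) (\det (frame L)) ^+ 2.
Proof.
move=> n0 E; rewrite /singular_form E !det_mulmx det_tr det_map_mx mulrAC mulrC.
rewrite mul_mpolyC linearZ /=; congr (_ *: _).
(* Each factor [\det (frame L)] has degree at most n - 1, so homogenization in degree 2n - 2 splits
   as a product. *)
have -> : (2 * n - 2 = (n - 1) + (n - 1))%N by rewrite addnn -mul2n mulnBr.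
by rewrite homogenizeM ?deg_le_det_frame // -expr2.
Qed.

Theorem theorem4p1 (R : realType) (K : numFieldType)
    (K_real_or_complex :
       K = (R : numFieldType) \/ K = (complex R : numFieldType))
    (n : nat) (n_ge1 : (1 <= n)%N)
    (U : set 'rV[K]_n) (U_open : open U) (U_connected : connected U)
    (U_nonempty : U !=set0)
    (g : 'rV[K]_n -> 'M[K]_n) (c : 'I_n -> 'I_n -> 'I_n -> 'rV[K]_n -> K)
    (J_hamiltonian : hamiltonian U g c) :
  (exists Q, is_monge_metric_of U g Q) /\
  (forall Q, is_monge_metric_of U g Q ->
     exists (kappa : K) (S : {mpoly K[n.+1]}),
       [/\ kappa != 0,
           homogeneous (n - 1)%N S
         & singular_form Q = kappa *: S ^+ 2]).
Proof.
have [u0 Uu0] := U_nonempty.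
have hM := is_monge_metric_hamiltonian K_real_or_complex U_open U_connected
  J_hamiltonian Uu0.
split=> [|Q hQ]; first by eexists; exact: hM.
have E := monge_metric_unique U_open U_nonempty hQ hM.
rewrite monge_metric_frame in E.
(* From g = Phi^T g(u0) Phi: kappa is det g(u0) and S is the homogenized det Phi. *)
exists (\det (g u0)), (homogenize (n - 1) (\det (frame (hamiltonian_coef g c u0)))).
split; first exact: metric_nondegenerate J_hamiltonian _ Uu0.
  exact/homogenize_homog/deg_le_det_frame.
exact: singular_form_frame E.
Qed.
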